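(* Fix an integer $n\ge2$. For real $p>1$ let $$g_1(p)=\frac1n\, e^{\frac{(p-1)n}{p}}\Big(\frac{(p-1)n}{p}\Big)^{\frac np}\Gamma\Big(1-\frac np,\frac{(p-1)n}{p}\Big),\qquad g_2(p)=1-\frac{p}{n-1}\,\frac{\Gamma(\frac{n+p-2}{p})\,\Gamma(\frac np)}{\Gamma(\frac{n-1}{p})^2}.$$ Then $\lim_{p\to+\infty}g_1(p)=\lim_{p\to+\infty}g_2(p)=\frac1n$.
   Context: $\Gamma(\cdot)$ is the Gamma function and $\Gamma(s,x)=\int_x^{+\infty}t^{s-1}e^{-t}\,dt$ ($s\in\mathbb{R}$, $x>0$) is the upper incomplete gamma function. *)

(* Defs.v *)
From HB Require Import structures.
From mathcomp Require Import all_boot all_order all_algebra.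
From mathcomp Require Import all_classical all_reals all_analysis.

Set Implicit Arguments.
Unset Strict Implicit.
Unset Printing Implicit Defensive.

Import Order.TTheory GRing.Theory Num.Theory.
Import numFieldNormedType.Exports.

Local Open Scope classical_set_scope.
Local Open Scope ring_scope.

(* Euler's integral, meaningful for s > 0; for s <= 0 the integral diverges
   and [Rintegral] returns 0 instead of the analytic continuation.  Only
   positive arguments occur in [g2] when 2 <= n and 1 < p. *)
Definition Gamma (R : realType) (s : R) : R :=
  \int[@lebesgue_measure R]_(t in `]0, +oo[) (t `^ (s - 1) * expR (- t)).

(* The integral converges for every real s as soon as x > 0. *)
Definition upper_Gamma (R : realType) (s x : R) : R :=
  \int[@lebesgue_measure R]_(t in `[x, +oo[) (t `^ (s - 1) * expR (- t)).

Definition g1 (R : realType) (n : nat) (p : R) : R :=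
  n%:R^-1 * expR ((p - 1) * n%:R / p)
    * ((p - 1) * n%:R / p) `^ (n%:R / p)
    * upper_Gamma (1 - n%:R / p) ((p - 1) * n%:R / p).

Definition g2 (R : realType) (n : nat) (p : R) : R :=
  1 - p / (n%:R - 1)
      * (Gamma ((n%:R + p - 2) / p) * Gamma (n%:R / p)
         / Gamma ((n%:R - 1) / p) ^+ 2).

(* Main.v *)
Require Import Defs.
From HB Require Import structures.
From mathcomp Require Import all_boot all_order all_algebra.
From mathcomp Require Import all_classical all_reals all_analysis.
From mathcomp Require Import measurable_realfun ring lra.

Import Order.TTheory GRing.Theory Num.Theory.
Import numFieldNormedType.Exports.

Local Open Scope classical_set_scope.
Local Open Scope ring_scope.

(** Both limits follow from squeezing the integrals between integrals that have
an elementary antiderivative; the resulting bounds are explicit in [p].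

For [g1], put [e = n/p] and [x = (p-1)n/p]. On the ray [t > x] the tangent-line
inequality [t/x <= exp(t/x - 1)] gives
[exp(-e (t/x - 1)) <= (t/x)^(-e) <= 1]; after multiplication by [exp(x-t)] both
ends are exponentials, and [upper_Gamma_bounds] reads
[1/(1 + e/x) <= exp(x) x^e Gamma(1-e, x) <= 1]. Here [e/x = 1/(p-1)], so
[n g1(p)] lies between [1 - 1/p] and [1].

For [g2], three Gamma values occur: one at [1 + (n-2)/p], tending to the
argument 1, and two at [n/p] and [(n-1)/p], tending to the pole at 0. The
substitution [u = 1 - exp(-t)] maps the half-line to the unit interval and
[exp(-t) dt] to [du], and the comparison [u <= t <= u exp(t)] bounds [t^(s-1)]
by powers of [u] and [1-u]. This yields [1/s - 1/(s+1) <= Gamma(s) <= 1/s] for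
[0 < s <= 1] ([Gamma_bounds_le1]). In the same way
[1/a <= Gamma(a) <= 1/(2-a)] for [1 <= a < 2] ([Gamma_bounds_ge1]).
Hence [s Gamma(s) -> 1] at [0+] and [Gamma(a) -> 1] at [1+], and in the ratio
defining [g2] the powers of [p] cancel, leaving [1 - (n-1)/n = 1/n]. *)

(** * Integrals over open rays *)

Lemma continuous_measurable_fun_ray (R : realType) (a : R) (f : R -> R) :
  (forall x, a < x -> {for x, continuous f}) ->
  measurable_fun `]a, +oo[ f.
Proof.
move=> cf; apply: open_continuous_measurable_fun => // x.
by rewrite inE /= in_itv /= andbT; exact: cf.
Qed.

(** The integrand may be unbounded at [a], as [u^(s-1)] is for [s < 1]: only the
one-sided limit of the antiderivative is used there. The ray is exhausted by the
closed rays starting at [a + 1/(k+1)]. *)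
Lemma ge0_FTC2_oy (R : realType) (f F : R -> R) (a l0 l : R) :
  (forall x, a < x -> 0 <= f x) ->
  (forall x, a < x -> {for x, continuous f}) ->
  (forall x, a < x -> is_derive x 1 F (f x)) ->
  F x @[x --> a^'+] --> l0 ->
  F x @[x --> +oo] --> l ->
  (\int[@lebesgue_measure R]_(x in `]a, +oo[) (f x)%:E = (l - l0)%:E)%E.
Proof.
move=> f0 cf dF Fa Fl.
pose b (k : nat) : R := a + k.+1%:R^-1.
have ab k : a < b k by rewrite ltrDl invr_gt0 ltr0n.
pose E (k : nat) : set R := `[b k, +oo[%classic.
have bigE : \bigcup_k E k = `]a, +oo[%classic.
  apply/seteqP; split => x /=.
    by move=> [k _]; rewrite /E /= !in_itv /= !andbT; exact: lt_le_trans.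
  rewrite in_itv /= andbT => ax.
  have xa0 : 0 < x - a by rewrite subr_gt0.
  have [k _ kx] := near_infty_natSinv_lt (PosNum xa0).
  exists k => //; rewrite /E /= in_itv /= andbT /b.
  by rewrite addrC -lerBrDr; apply/ltW/kx => /=.
have intE k :
  (\int[@lebesgue_measure R]_(x in E k) (f x)%:E = (l - F (b k))%:E)%E.
  have bx x : b k <= x -> a < x by exact: lt_le_trans.
  rewrite /E (@ge0_continuous_FTC2y _ f F (b k) l) ?EFinB//.
  - by move=> x /bx; exact: f0.
  - apply/continuous_within_itvcyP; split.
      move=> x; rewrite in_itv /= andbT => /ltW/bx; exact: cf.
    by apply: cvg_at_right_filter; exact: cf.
  - by move=> x /ltW/bx/dF[].
  - apply: cvg_at_right_filter; apply: differentiable_continuous.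
    by apply/derivable1_diffP; case: (dF _ (ab k)).
  - move=> x; rewrite in_itv /= andbT => /ltW/bx/dF [_ <-].
    by rewrite derive1E.
have mf := continuous_measurable_fun_ray _ _ _ cf.
have subE k : E k `<=` `]a, +oo[%classic.
  by rewrite -bigE; exact: bigcup_sup.
have lim1 : (\int[@lebesgue_measure R]_(x in E k) (f x)%:E @[k --> \oo] -->
   \int[@lebesgue_measure R]_(x in `]a, +oo[) (f x)%:E)%E.
  rewrite -bigE; apply: ge0_nondecreasing_set_cvg_integral.
  - move=> m k mk; apply/subsetPset => x; rewrite /E /= !in_itv /= !andbT.
    by apply: le_trans; rewrite /b lerD2l lef_pV2 ?posrE ?ltr0n// ler_nat.
  - by move=> k; exact: measurable_itv.
  - by move=> k; apply/measurable_EFinP; exact: measurable_funS (subE k) mf.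
  - move=> k x /subE; rewrite /= in_itv /= andbT => ax.
    by rewrite lee_fin f0.
have limb : F (b k) @[k --> \oo] --> l0.
  have /cvg_at_rightP := Fa; apply; split => //.
  rewrite -[X in _ --> X]addr0; apply: cvgD; first exact: cvg_cst.
  exact: cvg_harmonic.
have lim2 : (\int[@lebesgue_measure R]_(x in E k) (f x)%:E @[k --> \oo] -->
   (l - l0)%:E)%E.
  rewrite (_ : (fun k => _) = (fun k => (l - F (b k))%:E)); last exact/funext.
  by apply: cvg_EFin; [exact: nearW|apply: cvgB => //; exact: cvg_cst].
by have := cvg_unique _ lim1 lim2; apply.
Qed.

(** The real-valued integral is 0 when the extended one is infinite, so the
lower bound also relies on the finite integral of the majorant [h]. *)
Lemma Rintegral_between d (T : measurableType d) (R : realType)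
    (mu : {measure set T -> \bar R}) (D : set T) (f g h : T -> R) (a b : R) :
  measurable D -> measurable_fun D f -> measurable_fun D g ->
  measurable_fun D h ->
  (forall x, D x -> 0 <= f x) -> (forall x, D x -> f x <= g x) ->
  (forall x, D x -> g x <= h x) ->
  (\int[mu]_(x in D) (f x)%:E = a%:E)%E ->
  (\int[mu]_(x in D) (h x)%:E = b%:E)%E ->
  a <= \int[mu]_(x in D) g x <= b.
Proof.
move=> mD /measurable_EFinP mf /measurable_EFinP mg /measurable_EFinP mh.
move=> f0 fg gh fa hb.
have g0 x : D x -> 0 <= g x by move=> Dx; rewrite (le_trans (f0 _ Dx)) ?fg.
have h0 x : D x -> 0 <= h x by move=> Dx; rewrite (le_trans (g0 _ Dx)) ?gh.
have ag : (a%:E <= \int[mu]_(x in D) (g x)%:E)%E.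
  by rewrite -fa; apply: ge0_le_integral.
have gb : (\int[mu]_(x in D) (g x)%:E <= b%:E)%E.
  by rewrite -hb; apply: ge0_le_integral.
have gfin : (\int[mu]_(x in D) (g x)%:E)%E \is a fin_num.
  by rewrite fin_real// (lt_le_trans (ltNyr a) ag) (le_lt_trans gb (ltry b)).
by rewrite /Rintegral -!lee_fin fineK// ag gb.
Qed.

(** Transports a derivative computed by the combinators to the pointwise form of
the function and of its derivative. *)
Lemma is_derive1_eq_fun (R : realType) (f g : R -> R) (x df dg : R) :
  is_derive x 1 f df -> f =1 g -> df = dg -> is_derive x 1 g dg.
Proof. by move=> fd /funext <- <-. Qed.

Lemma is_derive1_continuous (R : realType) (f : R -> R) (x df : R) :
  is_derive x 1 f df -> {for x, continuous f}.
Proof.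
by move=> [fx _]; apply: differentiable_continuous; apply/derivable1_diffP.
Qed.

Lemma is_derive_expRM (R : realType) (c x : R) :
  is_derive x 1 (fun t => expR (c * t)) (c * expR (c * x)).
Proof.
have Zx : is_derive x 1 (fun t : R => c * t) c.
  apply: (is_derive1_eq_fun _ _ _ _ _ _
    (is_deriveZ c (is_derive_id x (1 : R)))) => //.
  by rewrite /GRing.scale /= mulr1.
rewrite [X in is_derive _ _ _ X]mulrC.
exact: is_derive1_eq_fun (is_derive1_comp (is_derive_expR (c * x)) Zx) _ _.
Qed.

Lemma cvg_expRM (R : realType) (b : R) : 0 < b ->
  expR (- b * x) @[x --> +oo] --> (0 : R).
Proof.
move=> b0.
have -> : (fun x : R => expR (- b * x)) =
    (fun y => expR (- y)) \o (fun x => b * x).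
  by apply/funext => x /=; rewrite mulNr.
apply: cvg_comp; last exact: cvgr_expR.
by apply: gt0_cvgMry => //; exact: cvg_id.
Qed.

Lemma integral_expR_ray (R : realType) (c a b : R) : 0 <= c -> 0 < b ->
  (\int[@lebesgue_measure R]_(x in `]a, +oo[) (c * expR (- b * x))%R%:E
   = (c * expR (- b * a) / b)%:E)%E.
Proof.
move=> c0 b0.
have -> : c * expR (- b * a) / b =
    - (c / b) * 0 - (- (c / b) * expR (- b * a)) by ring.
apply: (@ge0_FTC2_oy _ _ (fun x => - (c / b) * expR (- b * x))).
- by move=> x _; rewrite mulr_ge0 ?expR_ge0.
- move=> x _; apply: cvgMl_tmp.
  exact: is_derive1_continuous (is_derive_expRM _ _ _).
- move=> x _.
  apply: is_derive1_eq_fun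
    (is_deriveZ (- (c / b)) (is_derive_expRM _ (- b) x)) _ _.
    by [].
  by rewrite /GRing.scale /= mulrA mulrNN divfK// gt_eqF.
- apply: cvgMl_tmp; apply: cvg_at_right_filter.
  exact: is_derive1_continuous (is_derive_expRM _ _ _).
- by apply: cvgMl_tmp; exact: cvg_expRM.
Qed.

(** * The substitution u = 1 - exp(-t) *)

Lemma onem_expRN_gt0 (R : realType) (t : R) : 0 < t -> 0 < 1 - expR (- t).
Proof. by move=> t0; rewrite subr_gt0 expR_lt1 oppr_lt0. Qed.

Lemma onem_expRN_le (R : realType) (t : R) : 1 - expR (- t) <= t.
Proof. by have := expR_ge1Dx (- t); lra. Qed.

Lemma is_derive_powR_onem_expRN (R : realType) (a t : R) : 0 < t ->
  is_derive t 1 (fun t => (1 - expR (- t)) `^ a)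
    (a * ((1 - expR (- t)) `^ (a - 1) * expR (- t))).
Proof.
move=> t0.
have du : is_derive t 1 (fun t => 1 - expR (- t)) (expR (- t)).
  apply: is_derive1_eq_fun (is_deriveB (is_derive_cst (1 : R) t 1)
    (is_derive_expRM _ (- 1) t)) _ _.
    by move=> y; rewrite -(mulN1r y).
  by rewrite !mulN1r sub0r opprK.
have dp := is_derive1_powR a (onem_expRN_gt0 _ _ t0).
have dpu := @is_derive1_comp _ (@powR R ^~ a) (fun t => 1 - expR (- t)) t
  _ _ dp du.
apply: (is_derive1_eq_fun _ _ _ _ _ _ dpu); first by [].
by rewrite mulrA.
Qed.

(** Squeezed between 0 and [t^a], because [1 - exp(-t) <= t]. *)
Lemma powR_onem_expRN_cvg0 (R : realType) (a : R) : 0 < a ->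
  (1 - expR (- t)) `^ a @[t --> 0^'+] --> (0 : R).
Proof.
move=> a0; apply: (@squeeze_cvgr _ _ _ _ (fun=> 0) (fun t => t `^ a)).
- near=> t; have t0 : 0 < t by [].
  rewrite powR_ge0 /= ge0_ler_powR ?nnegrE ?onem_expRN_le//; apply/ltW => //.
  exact: onem_expRN_gt0.
- exact: cvg_cst.
- exact: powR_cvg0.
Unshelve. all: by end_near. Qed.

Lemma powR_onem_expRN_cvg1 (R : realType) (a : R) :
  (1 - expR (- t)) `^ a @[t --> +oo] --> (1 : R).
Proof.
have u1 : 1 - expR (- t) @[t --> +oo] --> (1 : R).
  rewrite -[X in _ --> X]subr0; apply: cvgB; first exact: cvg_cst.
  exact: cvgr_expR.
have c1 : x `^ a @[x --> (1 : R)] --> (1 : R).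
  have p1 : 1 `^ a = 1 :> R by rewrite powR1.
  rewrite -[X in _ --> X]p1.
  exact: is_derive1_continuous (is_derive1_powR a ltr01).
exact: (cvg_comp _ _ u1 c1).
Qed.

Lemma continuous_powR_expRN (R : realType) (a t : R) : 0 < t ->
  {for t, continuous (fun t => t `^ a * expR (- t))}.
Proof.
move=> t0; apply: cvgM.
  exact: is_derive1_continuous (is_derive1_powR a t0).
by apply: continuous_comp; [exact: opp_continuous|exact: continuous_expR].
Qed.

Lemma continuous_powR_onem_expRN (R : realType) (a t : R) : 0 < t ->
  {for t, continuous (fun t => (1 - expR (- t)) `^ a * expR (- t))}.
Proof.
move=> t0; apply: cvgM.
  exact: is_derive1_continuous (is_derive_powR_onem_expRN _ _ _ t0).
by apply: continuous_comp; [exact: opp_continuous|exact: continuous_expR].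
Qed.

(** With [u = 1 - exp(-t)] this is the integral of [u^(a-1)] over the unit
interval. *)
Lemma integral_powR_onem_expR (R : realType) (a : R) : 0 < a ->
  (\int[@lebesgue_measure R]_(t in `]0%R, +oo[)
     ((1 - expR (- t)) `^ (a - 1) * expR (- t))%R%:E = (a^-1)%:E)%E.
Proof.
move=> a0; have -> : a^-1 = a^-1 * 1 - a^-1 * 0 by ring.
apply: (@ge0_FTC2_oy _ _ (fun t => a^-1 * (1 - expR (- t)) `^ a)).
- by move=> t _; rewrite mulr_ge0 ?powR_ge0 ?expR_ge0.
- by move=> t; exact: continuous_powR_onem_expRN.
- move=> t t0.
  apply: is_derive1_eq_fun
    (is_deriveZ a^-1 (is_derive_powR_onem_expRN _ a t t0)) _ _.
    by move=> y; reflexivity.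
  by rewrite /GRing.scale /= mulKf ?gt_eqF.
- by apply: cvgMl_tmp; exact: powR_onem_expRN_cvg0.
- by apply: cvgMl_tmp; exact: powR_onem_expRN_cvg1.
Qed.

(** With [u = 1 - exp(-t)] this is the integral of [u^(a-1) (1-u)] over the unit
interval. *)
Lemma integral_powR_onem_expR2 (R : realType) (a : R) : 0 < a ->
  (\int[@lebesgue_measure R]_(t in `]0%R, +oo[)
     ((1 - expR (- t)) `^ (a - 1) * expR (- t) * expR (- t))%R%:E
   = (a^-1 - (a + 1)^-1)%:E)%E.
Proof.
move=> a0; pose u (t : R) := 1 - expR (- t).
pose G t := a^-1 * u t `^ a - (a + 1)^-1 * u t `^ (a + 1).
have a10 : 0 < a + 1 by lra.
have -> : a^-1 - (a + 1)^-1 = (a^-1 * 1 - (a + 1)^-1 * 1)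
  - (a^-1 * 0 - (a + 1)^-1 * 0) by ring.
apply: (@ge0_FTC2_oy _ _ G).
- by move=> t _; rewrite !mulr_ge0 ?powR_ge0 ?expR_ge0.
- move=> t t0; apply: cvgM; first exact: continuous_powR_onem_expRN.
  by apply: continuous_comp; [exact: opp_continuous|exact: continuous_expR].
- move=> t t0.
  apply: is_derive1_eq_fun (is_deriveB
    (is_deriveZ a^-1 (is_derive_powR_onem_expRN _ a t t0))
    (is_deriveZ (a + 1)^-1 (is_derive_powR_onem_expRN _ (a + 1) t t0))) _ _.
    by move=> y; reflexivity.
  rewrite /GRing.scale /= addrK !mulKf ?gt_eqF//.
  have -> : (1 - expR (- t)) `^ a =
      (1 - expR (- t)) * (1 - expR (- t)) `^ (a - 1).
    by rewrite mulr_powRB1// ltW// onem_expRN_gt0.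
  ring.
- by apply: cvgB; apply: cvgMl_tmp; exact: powR_onem_expRN_cvg0.
- by apply: cvgB; apply: cvgMl_tmp; exact: powR_onem_expRN_cvg1.
Qed.

(** * Bounds for the Gamma functions *)

Lemma ler_npowR (R : realType) (c x y : R) : c <= 0 -> 0 < x -> x <= y ->
  y `^ c <= x `^ c.
Proof.
move=> c0 x0 xy; have y0 := lt_le_trans x0 xy.
rewrite -[c]opprK !(powRN _ (- c)) lef_pV2 ?posrE ?powR_gt0//.
by rewrite ge0_ler_powR ?nnegrE ?oppr_ge0//; exact: ltW.
Qed.

Lemma in_ray (R : realType) (a x : R) : `]a, +oo[%classic x -> a < x.
Proof. by rewrite /= in_itv /= andbT. Qed.

(** This is [1 + t <= exp(t)] multiplied by [exp(-t)]. *)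
Lemma mulr_expRN_le_onem (R : realType) (t : R) :
  t * expR (- t) <= 1 - expR (- t).
Proof.
have := ler_wpM2r (expR_ge0 (- t)) (expR_ge1Dx t).
by rewrite expRxMexpNx_1 mulrDl mul1r; lra.
Qed.

(** Let [u = 1 - exp(-t)], so that [u <= t <= u exp(t)]. The exponent [s-1] is
nonpositive, whence [u^(s-1) exp(-t) <= t^(s-1) <= u^(s-1)]: the factor
[exp(-(1-s)t)] lost on the left is weakened to [exp(-t)]. *)
Lemma Gamma_bounds_le1 (R : realType) (s : R) : 0 < s -> s <= 1 ->
  s^-1 - (s + 1)^-1 <= Gamma s <= s^-1.
Proof.
move=> s0 s1; have s10 : s - 1 <= 0 by lra.
apply: (@Rintegral_between _ _ R (@lebesgue_measure R) `]0, +oo[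
  (fun t => (1 - expR (- t)) `^ (s - 1) * expR (- t) * expR (- t))
  (fun t => t `^ (s - 1) * expR (- t))
  (fun t => (1 - expR (- t)) `^ (s - 1) * expR (- t))).
- exact: measurable_itv.
- apply: continuous_measurable_fun_ray => t t0; apply: cvgM.
    exact: continuous_powR_onem_expRN.
  by apply: continuous_comp; [exact: opp_continuous|exact: continuous_expR].
- by apply: continuous_measurable_fun_ray => t; exact: continuous_powR_expRN.
- apply: continuous_measurable_fun_ray => t.
  exact: continuous_powR_onem_expRN.
- by move=> t _; rewrite !mulr_ge0 ?powR_ge0 ?expR_ge0.
- move=> t /in_ray t0; rewrite ler_wpM2r ?expR_ge0//.
  have te0 : 0 < t * expR (- t) by rewrite mulr_gt0 ?expR_gt0.
  (* t^(s-1) exp(-t)^(s-1) exp(-t) = t^(s-1) exp(-st), and exp(-st) <= 1. *)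
  apply: (le_trans (ler_wpM2r (expR_ge0 _)
    (ler_npowR _ _ _ _ s10 te0 (mulr_expRN_le_onem _ t)))).
  rewrite powRM ?expR_ge0 ?(ltW t0)// -mulrA ler_piMr ?powR_ge0//.
  rewrite -expRM -expRD (_ : _ + _ = - (t * s)); last by ring.
  by rewrite expR_le1 oppr_le0 mulr_ge0 ?ltW.
- move=> t /in_ray t0; rewrite ler_wpM2r ?expR_ge0// ler_npowR//.
    exact: onem_expRN_gt0.
  exact: onem_expRN_le.
- exact: integral_powR_onem_expR2.
- exact: integral_powR_onem_expR.
Qed.

(** The exponent [a-1] is nonnegative, so [1 - exp(-t) <= t] bounds the
integrand below and [t <= exp(t)] bounds it above by [exp(-(2-a)t)]. *)
Lemma Gamma_bounds_ge1 (R : realType) (a : R) : 1 <= a -> a < 2 ->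
  a^-1 <= Gamma a <= (2 - a)^-1.
Proof.
move=> a1 a2; have a10 : 0 <= a - 1 by lra.
apply: (@Rintegral_between _ _ R (@lebesgue_measure R) `]0, +oo[
  (fun t => (1 - expR (- t)) `^ (a - 1) * expR (- t))
  (fun t => t `^ (a - 1) * expR (- t))
  (fun t => 1 * expR (- (2 - a) * t))).
- exact: measurable_itv.
- apply: continuous_measurable_fun_ray => t.
  exact: continuous_powR_onem_expRN.
- by apply: continuous_measurable_fun_ray => t; exact: continuous_powR_expRN.
- apply: continuous_measurable_fun_ray => t _; apply: cvgMl_tmp.
  exact: is_derive1_continuous (is_derive_expRM _ _ _).
- by move=> t _; rewrite mulr_ge0 ?powR_ge0 ?expR_ge0.
- move=> t /in_ray t0; rewrite ler_wpM2r ?expR_ge0//.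
  by rewrite ge0_ler_powR ?nnegrE ?onem_expRN_le// ltW// onem_expRN_gt0.
- move=> t /in_ray t0.
  have tet : t <= expR t by have := expR_ge1Dx t; lra.
  rewrite mul1r (_ : - (2 - a) * t = t * (a - 1) + - t); last by ring.
  rewrite expRD expRM ler_wpM2r ?expR_ge0//.
  by rewrite ge0_ler_powR ?nnegrE ?expR_ge0//; exact: ltW.
- by apply: integral_powR_onem_expR; lra.
- rewrite integral_expR_ray ?ler01//; last by lra.
  by rewrite mulr0 expR0 !mul1r.
Qed.

(** For [t > x], raising [t <= x exp(t/x - 1)] to the power [-e] gives
[x^(-e) exp(e - e t/x) <= t^(-e) <= x^(-e)], and both bounds have explicit
integrals against [exp(-t)]. *)
Lemma upper_Gamma_bounds (R : realType) (e x : R) : 0 <= e -> 0 < x ->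
  (1 + e / x)^-1 <= expR x * x `^ e * upper_Gamma (1 - e) x <= 1.
Proof.
move=> e0 x0.
have b0 : 0 < 1 + e / x by rewrite ltr_pwDl// divr_ge0// ltW.
have K0 : 0 <= expR x * x `^ e by rewrite mulr_ge0 ?expR_ge0 ?powR_ge0.
have xe0 : x `^ e != 0 by rewrite gt_eqF// powR_gt0.
have ex0 : expR x != 0 by rewrite gt_eqF// expR_gt0.
have Ux : upper_Gamma (1 - e) x =
    \int[@lebesgue_measure R]_(t in `]x, +oo[) (t `^ (- e) * expR (- t)).
  rewrite /upper_Gamma [1 - e - 1]addrAC subrr sub0r /Rintegral.
  congr fine; rewrite -integral_itv_obnd_cbnd//.
  apply/measurable_EFinP; apply: continuous_measurable_fun_ray => t xt.
  by apply: continuous_powR_expRN; exact: lt_trans xt.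
have /andP[] : x `^ (- e) * expR e * expR (- (1 + e / x) * x) / (1 + e / x)
    <= upper_Gamma (1 - e) x <= x `^ (- e) * expR (- 1 * x) / 1.
  rewrite Ux {Ux}.
  apply: (@Rintegral_between _ _ R (@lebesgue_measure R) `]x, +oo[
    (fun t => x `^ (- e) * expR e * expR (- (1 + e / x) * t))
    (fun t => t `^ (- e) * expR (- t))
    (fun t => x `^ (- e) * expR (- 1 * t))).
  - exact: measurable_itv.
  - apply: continuous_measurable_fun_ray => t _; apply: cvgMl_tmp.
    exact: is_derive1_continuous (is_derive_expRM _ _ _).
  - apply: continuous_measurable_fun_ray => t xt.
    by apply: continuous_powR_expRN; exact: lt_trans xt.
  - apply: continuous_measurable_fun_ray => t _; apply: cvgMl_tmp.
    exact: is_derive1_continuous (is_derive_expRM _ _ _).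
  - by move=> t _; rewrite !mulr_ge0 ?powR_ge0 ?expR_ge0.
  - move=> t /in_ray xt; have t0 := lt_trans x0 xt.
    have tx : t <= x * expR (t / x - 1).
      have := ler_wpM2l (ltW x0) (expR_ge1Dx (t / x - 1)).
      by rewrite addrC subrK mulrCA divff ?mulr1// gt_eqF.
    have ne0 : - e <= 0 by rewrite oppr_le0.
    have := ler_npowR _ _ _ _ ne0 t0 tx.
    rewrite powRM ?expR_ge0 ?(ltW x0)// -expRM.
    move=> /(ler_wpM2r (expR_ge0 (- t))); apply: le_trans.
    rewrite -!mulrA -!expRD ler_wpM2l ?powR_ge0// ler_expR le_eqVlt.
    by apply/orP; left; apply/eqP; field; rewrite gt_eqF.
  - move=> t /in_ray xt; rewrite mulN1r ler_wpM2r ?expR_ge0//.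
    by rewrite ler_npowR ?oppr_le0//; exact: ltW.
  - by rewrite integral_expR_ray ?mulr_ge0 ?powR_ge0 ?expR_ge0.
  - by rewrite integral_expR_ray ?powR_ge0.
move=> {Ux} /(ler_wpM2l K0) lo /(ler_wpM2l K0) hi; apply/andP; split.
- apply: le_trans lo; rewrite le_eqVlt; apply/orP; left; apply/eqP.
  rewrite (_ : - (1 + e / x) * x = - e + - x); last by field; rewrite gt_eqF.
  rewrite expRD !expRN powRN; field.
  by rewrite xe0 ex0 !gt_eqF ?expR_gt0 ?ltr_wpDr.
- apply: (le_trans hi); rewrite le_eqVlt; apply/orP; left; apply/eqP.
  by rewrite mulN1r expRN powRN; field; rewrite xe0 ex0.
Qed.

(** * The two limits *)

Lemma cvg_cst_div (R : realType) (c : R) : c / p @[p --> +oo] --> (0 : R).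
Proof.
rewrite -[X in _ --> X](mulr0 c); apply: cvgMl_tmp.
apply/gtr0_cvgV0; last exact: cvg_id.
by near=> p.
Unshelve. all: by end_near. Qed.

Lemma cvg_1D_div (R : realType) (c : R) : 1 + c / p @[p --> +oo] --> (1 : R).
Proof.
rewrite -[X in _ --> X]addr0; apply: cvgD; first exact: cvg_cst.
exact: cvg_cst_div.
Qed.

Lemma cvgV1 (R : realType) (f : R -> R) : f p @[p --> +oo] --> (1 : R) ->
  (f p)^-1 @[p --> +oo] --> (1 : R).
Proof.
move=> f1; rewrite -[X in _ --> X]invr1; apply: cvgV => //; exact: oner_neq0.
Qed.

Lemma cvg_Gamma_1D (R : realType) (c : R) : 0 <= c ->
  Gamma (1 + c / p) @[p --> +oo] --> (1 : R).
Proof.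
move=> c0; apply: (@squeeze_cvgr _ _ _ _ (fun p => (1 + c / p)^-1)
  (fun p => (1 + - c / p)^-1)).
- near=> p.
  have p0 : 0 < p by [].
  have cp0 : 0 <= c / p by rewrite divr_ge0// ltW.
  have cp1 : c / p < 1 by
    rewrite ltr_pdivrMr// mul1r; near: p; exact/nbhs_pinfty_gt/num_real.
  rewrite (_ : 1 + - c / p = 2 - (1 + c / p)); last by ring.
  by apply: Gamma_bounds_ge1; lra.
- exact/cvgV1/cvg_1D_div.
- exact/cvgV1/cvg_1D_div.
Unshelve. all: by end_near. Qed.

Lemma cvg_mulr_Gamma (R : realType) (c : R) : 0 < c ->
  c / p * Gamma (c / p) @[p --> +oo] --> (1 : R).
Proof.
move=> c0; apply: (@squeeze_cvgr _ _ _ _ (fun p => (1 + c / p)^-1) (fun=> 1)).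
- near=> p.
  have p0 : 0 < p by [].
  have s0 : 0 < c / p by rewrite divr_gt0.
  have s1 : c / p <= 1 by
    rewrite ler_pdivrMr// mul1r; near: p; exact/nbhs_pinfty_ge/num_real.
  have /andP[lo hi] := Gamma_bounds_le1 _ _ s0 s1.
  set s := c / p in s0 s1 lo hi *.
  have := ler_wpM2l (ltW s0) hi; have := ler_wpM2l (ltW s0) lo.
  rewrite divff ?gt_eqF// => + ->; rewrite andbT; apply: le_trans.
  rewrite le_eqVlt; apply/orP; left; apply/eqP; field.
  by rewrite !gt_eqF//; lra.
- exact/cvgV1/cvg_1D_div.
- exact: cvg_cst.
Unshelve. all: by end_near. Qed.

(** With [e = n/p] and [x = (p-1)n/p] one has [e/x = 1/(p-1)], so the lower
bound [1/(1 + e/x)] is [1 - 1/p]. *)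
Lemma cvg_g1 (R : realType) (n : nat) : (0 < n)%N ->
  g1 n p @[p --> +oo] --> (n%:R^-1 : R).
Proof.
move=> n0; have nR0 : 0 < n%:R :> R by rewrite ltr0n.
rewrite -[X in _ --> X]mulr1.
have -> : g1 n = fun p : R => n%:R^-1 * (expR ((p - 1) * n%:R / p) *
    ((p - 1) * n%:R / p) `^ (n%:R / p) *
    upper_Gamma (1 - n%:R / p) ((p - 1) * n%:R / p)).
  by apply/funext => p; rewrite /g1 !mulrA.
apply: cvgMl_tmp.
apply: (@squeeze_cvgr _ _ _ _ (fun p => 1 + - 1 / p) (fun=> 1)).
- near=> p.
  have p1 : 1 < p by [].
  have p0 : 0 < p by lra.
  have pm0 : 0 < p - 1 by lra.
  have e0 : 0 <= n%:R / p by rewrite divr_ge0// ltW.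
  have x0 : 0 < (p - 1) * n%:R / p by rewrite divr_gt0// mulr_gt0.
  have := upper_Gamma_bounds _ _ _ e0 x0.
  rewrite (_ : (1 + n%:R / p / ((p - 1) * n%:R / p))^-1 = 1 + - 1 / p)//.
  field.
  by rewrite !gt_eqF//=; lra.
- exact: cvg_1D_div.
- exact: cvg_cst.
Unshelve. all: by end_near. Qed.

(** With [A = Gamma(1 + (n-2)/p)] and [B_c = (c/p) Gamma(c/p)], all tending to
1, the powers of [p] cancel and [g2] equals [1 - (n-1)/n A B_n / B_(n-1)^2] for
large [p]. *)
Lemma cvg_g2 (R : realType) (n : nat) : (2 <= n)%N ->
  g2 n p @[p --> +oo] --> (n%:R^-1 : R).
Proof.
move=> n2; have nR2 : 2 <= n%:R :> R by rewrite ler_nat.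
pose N : R := n%:R.
have N0 : 0 < N by rewrite /N; lra.
have N1 : 0 < N - 1 by rewrite /N; lra.
pose A (p : R) := Gamma (1 + (N - 2) / p).
pose B c (p : R) := c / p * Gamma (c / p).
have limAB : 1 - (N - 1) / N * (A p * B N p * (B (N - 1) p * B (N - 1) p)^-1)
    @[p --> +oo] --> 1 - (N - 1) / N * (1 * 1 * (1 * 1)^-1).
  apply: cvgB; first exact: cvg_cst.
  apply: cvgMl_tmp; apply: cvgM.
    apply: cvgM; last exact: cvg_mulr_Gamma.
    by apply: cvg_Gamma_1D; rewrite subr_ge0.
  rewrite mulr1 invr1; apply: cvgV1; rewrite -[X in _ --> X]mulr1.
  by apply: cvgM; exact: cvg_mulr_Gamma.
have -> : n%:R^-1 = 1 - (N - 1) / N * (1 * 1 * (1 * 1)^-1).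
  by rewrite -/N; field; rewrite gt_eqF.
apply: cvg_trans limAB; apply: near_eq_cvg; near=> p.
have p0 : 0 < p by [].
(* This keeps (N-1)/p in the range where Gamma is bounded away from 0. *)
have pN : N - 1 <= p by near: p; exact/nbhs_pinfty_ge/num_real.
have G0 : 0 < Gamma ((N - 1) / p).
  have s0 : 0 < (N - 1) / p by rewrite divr_gt0.
  have s1 : (N - 1) / p <= 1 by rewrite ler_pdivrMr// mul1r.
  have /andP[+ _] := Gamma_bounds_le1 _ _ s0 s1; apply: lt_le_trans.
  by rewrite subr_gt0 ltf_pV2 ?posrE//; lra.
rewrite /g2 /A /B -/N (_ : (N + p - 2) / p = 1 + (N - 2) / p).
  by field; rewrite !gt_eqF.
by field; rewrite gt_eqF.
Unshelve. all: by end_near. Qed.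

Theorem mainTheorem4 (R : realType) (n : nat) (hn : (2 <= n)%N) :
  g1 n p @[p --> +oo] --> (n%:R^-1 : R) /\
  g2 n p @[p --> +oo] --> (n%:R^-1 : R).
Proof. by split; [apply: cvg_g1; exact: ltnW|exact: cvg_g2]. Qed.
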